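(* Let $n\ge 2$, let $r\ge 1$ and let $p\mid r$, $d=r/p$. Let $\xi\in\mathbb{C}$ be a primitive $p$-th root of unity, let $0\ne q\in\mathbb{C}$, let $v_0,\dots,v_{d-1}\in\mathbb{C}\setminus\{0\}$, and for $1\le j\le r$ put $u_j=\xi^k v_l$ if $j-1=lp+k$ with $0\le k\le p-1$, $0\le l\le d-1$ (so that $(T_1-u_1)\cdots(T_1-u_r)=(T_1^p-v_0^p)\cdots(T_1^p-v_{d-1}^p)$). Write $\mathcal{H}_{r,1,n}=\mathcal{H}_{r,1,n}(u_1,\dots,u_r,q)$ and $\mathcal{H}_{r,p,n}=\mathcal{H}_{r,p,n}(v_0,\dots,v_{d-1},q)$ for the algebras defined in the context. Then the assignment $$\tau(T_1)=\xi T_1,\qquad \tau(T_i)=T_i\quad(2\le i\le n)$$ induces an algebra automorphism $\tau$ of $\mathcal{H}_{r,1,n}$ and an action of the group $\mathbb{Z}/p\mathbb{Z}=\langle\tau\rangle$ on $\mathcal{H}_{r,1,n}$ by algebra automorphisms, and $$\mathcal{H}_{r,p,n}=(\mathcal{H}_{r,1,n})^{\mathbb{Z}/p\mathbb{Z}}.$$ Furthermore, let $\tau$ also denote the automorphism of $\mathcal{H}_{\infty,1,n}(q)$ given by $\tau(X)=\xi X$, $\tau(T_i)=T_i$ for $2\le i\le n$, and let $\phi:\mathcal{H}_{\infty,1,n}(q)\to\mathcal{H}_{r,1,n}$ be the quotient map $X\mapsto T_1$, $T_i\mapsto T_i$. Then the diagram $$\begin{array}{ccccc} \mathcal{H}_{\infty,p,n}(q)&\hookrightarrow&\mathcal{H}_{\infty,1,n}(q)&\xrightarrow{\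 \tau\ }&\mathcal{H}_{\infty,1,n}(q)\\ \downarrow{\phi}&&\downarrow{\phi}&&\downarrow{\phi}\\ \mathcal{H}_{r,p,n}&\hookrightarrow&\mathcal{H}_{r,1,n}&\xrightarrow{\ \tau\ }&\mathcal{H}_{r,1,n} \end{array}$$ commutes (the left vertical map is the restriction of $\phi$, which maps $\mathcal{H}_{\infty,p,n}(q)$ into $\mathcal{H}_{r,p,n}$).
   Context: The cyclotomic Hecke algebra $\mathcal{H}_{r,1,n}(u_1,\dots,u_r,q)$ is the $\mathbb{C}$-algebra with generators $T_1,\dots,T_n$ and relations: (1) $T_iT_j=T_jT_i$ if $|i-j|>1$; (2) $T_iT_{i+1}T_i=T_{i+1}T_iT_{i+1}$ for $2\le i\le n-1$; (3) $T_1T_2T_1T_2=T_2T_1T_2T_1$; (4) $(T_1-u_1)(T_1-u_2)\cdots(T_1-u_r)=0$; (5) $(T_i-1)(T_i+q)=0$ for $2\le i\le n$. $\mathcal{H}_{r,p,n}(v_0,\dots,v_{d-1},q)$ is the subalgebra of $\mathcal{H}_{r,1,n}(u_1,\dots,u_r,q)$ generated by $t_0=T_1^p$, $t_1=T_1^{-1}T_2T_1$ and $t_i=T_i$ for $2\le i\le n$. The affine Hecke algebra $\mathcal{H}_{\infty,1,n}(q)$ is the $\mathbb{C}$-algebra with an invertible generator $X$ and generators $T_2,\dots,T_n$, subject to relations (1), (2), (3), (5) with $T_1$ replaced by $X$ (relation (4) omitted). $\mathcal{H}_{\infty,p,n}(q)$ is its subalgebra generated by $X^{p}$, $X^{-p}$,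 $X^{-1}T_2X$ and $T_2,\dots,T_n$. *)

(* Defs.v *)
From HB Require Import structures.
From mathcomp Require Import all_boot all_fingroup all_algebra.
From mathcomp Require Import boolp classical_sets reals.
From mathcomp Require Import complex.
From mathcomp Require Import monalg generic_quotient.

Set Implicit Arguments.
Unset Strict Implicit.
Unset Printing Implicit Defensive.

Import GRing.Theory.
Local Open Scope ring_scope.
Local Open Scope quotient_scope.

Section QuotientAlgebra.
Variables (K : fieldType) (F : algType K).

(* Closure under scalars is the case a = c%:A of ideal_mull.  Algebras are
   nontrivial in the library, hence ideal_proper. *)
Record proper_ideal2 := ProperIdeal2 {
  ideal2_pred :> F -> Prop;
  ideal2_0 : ideal2_pred 0;
  ideal2_D : forall x y, ideal2_pred x -> ideal2_pred y -> ideal2_pred (x + y);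
  ideal2_mull : forall a x, ideal2_pred x -> ideal2_pred (a * x);
  ideal2_mulr : forall a x, ideal2_pred x -> ideal2_pred (x * a);
  ideal2_proper : ~ ideal2_pred 1 }.

Variable J : proper_ideal2.

Fact ideal2_N x : J x -> J (- x).
Proof. by rewrite -mulN1r; apply: ideal2_mull. Qed.

Fact ideal2_Z (c : K) x : J x -> J (c *: x).
Proof. by rewrite -[x in c *: x]mul1r scalerAl; apply: ideal2_mull. Qed.

Definition ideal2_equiv (x y : F) : bool := `[< J (x - y) >].

Fact ideal2_equiv_is_equiv : equiv_class_of ideal2_equiv.
Proof.
split=> [x|x y|y x z].
- by apply/asboolP; rewrite subrr; apply: ideal2_0.
- by apply/asboolP/asboolP => /ideal2_N; rewrite opprB.
move=> /asboolP Jxy /asboolP Jyz; apply/asboolP.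
by rewrite -(subrK y x) -addrA; apply: ideal2_D.
Qed.

Canonical ideal2_equiv_equiv := EquivRelPack ideal2_equiv_is_equiv.

Definition alg_quot := {eq_quot ideal2_equiv}.
HB.instance Definition _ := Choice.on alg_quot.
HB.instance Definition _ := Quotient.on alg_quot.

Definition quot_pi (x : F) : alg_quot := locked (\pi_alg_quot x).

Lemma quot_piP x y : quot_pi x = quot_pi y <-> J (x - y).
Proof.
rewrite /quot_pi -!lock; split=> [/eqmodP/asboolP //|Jxy].
by apply/eqmodP/asboolP.
Qed.

Lemma quot_pi_repr (a : alg_quot) : quot_pi (repr a) = a.
Proof. by rewrite /quot_pi -lock; apply: reprK. Qed.

Fact J_repr x : J (repr (quot_pi x) - x).
Proof. by apply/quot_piP; rewrite quot_pi_repr. Qed.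

(* The operations are locked to keep unification from computing in F. *)
Definition quot_zero := locked (quot_pi 0).
Definition quot_one := locked (quot_pi 1).
Definition quot_add := locked (fun a b : alg_quot => quot_pi (repr a + repr b)).
Definition quot_opp := locked (fun a : alg_quot => quot_pi (- repr a)).
Definition quot_mul := locked (fun a b : alg_quot => quot_pi (repr a * repr b)).
Definition quot_scale := locked (fun (c : K) (a : alg_quot) => quot_pi (c *: repr a)).

Fact quot_piD x y : quot_add (quot_pi x) (quot_pi y) = quot_pi (x + y).
Proof.
rewrite /quot_add -lock; apply/quot_piP; rewrite opprD addrACA.
by apply: ideal2_D; apply: J_repr.
Qed.

Fact quot_piN x : quot_opp (quot_pi x) = quot_pi (- x).
Proof.
rewrite /quot_opp -lock; apply/quot_piP; rewrite -opprD.
by apply: ideal2_N; apply: J_repr.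
Qed.

Fact quot_piM x y : quot_mul (quot_pi x) (quot_pi y) = quot_pi (x * y).
Proof.
rewrite /quot_mul -lock; apply/quot_piP.
rewrite -(subrK (x * repr (quot_pi y)) (_ * _)) -addrA -mulrBl -mulrBr.
by apply: ideal2_D; [apply: ideal2_mulr|apply: ideal2_mull]; apply: J_repr.
Qed.

Fact quot_piZ c x : quot_scale c (quot_pi x) = quot_pi (c *: x).
Proof.
rewrite /quot_scale -lock; apply/quot_piP; rewrite -scalerBr.
by apply: ideal2_Z; apply: J_repr.
Qed.

Fact quot_pi0 : quot_zero = quot_pi 0. Proof. by rewrite /quot_zero -lock. Qed.
Fact quot_pi1 : quot_one = quot_pi 1. Proof. by rewrite /quot_one -lock. Qed.

Lemma quot_ind (Q : alg_quot -> Prop) :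
  (forall x, Q (quot_pi x)) -> forall a, Q a.
Proof. by move=> H a; rewrite -(quot_pi_repr a). Qed.

Fact quot_addA : associative quot_add.
Proof.
elim/quot_ind=> x; elim/quot_ind=> y; elim/quot_ind=> z.
by rewrite !quot_piD addrA.
Qed.
Fact quot_addC : commutative quot_add.
Proof. by elim/quot_ind=> x; elim/quot_ind=> y; rewrite !quot_piD addrC. Qed.
Fact quot_add0 : left_id quot_zero quot_add.
Proof. by elim/quot_ind=> x; rewrite quot_pi0 quot_piD add0r. Qed.
Fact quot_addN : left_inverse quot_zero quot_opp quot_add.
Proof. by elim/quot_ind=> x; rewrite quot_piN quot_piD quot_pi0 addNr. Qed.

HB.instance Definition _ :=
  GRing.isZmodule.Build alg_quot quot_addA quot_addC quot_add0 quot_addN.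

Fact quot_mulA : associative quot_mul.
Proof.
elim/quot_ind=> x; elim/quot_ind=> y; elim/quot_ind=> z.
by rewrite !quot_piM mulrA.
Qed.
Fact quot_mul1 : left_id quot_one quot_mul.
Proof. by elim/quot_ind=> x; rewrite quot_pi1 quot_piM mul1r. Qed.
Fact quot_mulr1 : right_id quot_one quot_mul.
Proof. by elim/quot_ind=> x; rewrite quot_pi1 quot_piM mulr1. Qed.
Fact quot_mulDl : left_distributive quot_mul quot_add.
Proof.
elim/quot_ind=> x; elim/quot_ind=> y; elim/quot_ind=> z.
by rewrite quot_piD !quot_piM quot_piD mulrDl.
Qed.
Fact quot_mulDr : right_distributive quot_mul quot_add.
Proof.
elim/quot_ind=> x; elim/quot_ind=> y; elim/quot_ind=> z.
by rewrite quot_piD !quot_piM quot_piD mulrDr.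
Qed.
Fact quot_1neq0 : quot_one != quot_zero.
Proof.
apply/eqP; rewrite quot_pi0 quot_pi1 => /quot_piP; rewrite subr0.
exact: ideal2_proper.
Qed.

HB.instance Definition _ := GRing.Zmodule_isNzRing.Build alg_quot
  quot_mulA quot_mul1 quot_mulr1 quot_mulDl quot_mulDr quot_1neq0.

Fact quot_scaleA c d a : quot_scale c (quot_scale d a) = quot_scale (c * d) a.
Proof. by elim/quot_ind: a => x; rewrite !quot_piZ scalerA. Qed.
Fact quot_scale1 : left_id 1 quot_scale.
Proof. by elim/quot_ind=> x; rewrite quot_piZ scale1r. Qed.
Fact quot_scaleDr : right_distributive quot_scale quot_add.
Proof.
move=> c; elim/quot_ind=> x; elim/quot_ind=> y.
by rewrite quot_piD !quot_piZ quot_piD scalerDr.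
Qed.
Fact quot_scaleDl a : {morph quot_scale^~ a : c d / c + d >-> quot_add c d}.
Proof.
elim/quot_ind: a => x c d.
by rewrite !quot_piZ quot_piD -scalerDl.
Qed.

HB.instance Definition _ := GRing.Zmodule_isLmodule.Build K alg_quot
  quot_scaleA quot_scale1 quot_scaleDr quot_scaleDl.

Fact quot_scaleAl (c : K) a b :
  quot_scale c (quot_mul a b) = quot_mul (quot_scale c a) b.
Proof.
elim/quot_ind: a => x; elim/quot_ind: b => y.
by rewrite !(quot_piM, quot_piZ) scalerAl.
Qed.

HB.instance Definition _ :=
  GRing.Lmodule_isLalgebra.Build K alg_quot quot_scaleAl.

Fact quot_scaleAr (c : K) a b :
  quot_scale c (quot_mul a b) = quot_mul a (quot_scale c b).
Proof.
elim/quot_ind: a => x; elim/quot_ind: b => y.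
by rewrite !(quot_piM, quot_piZ) scalerAr.
Qed.

HB.instance Definition _ :=
  GRing.Lalgebra_isAlgebra.Build K alg_quot quot_scaleAr.

Definition quot_unit (a : alg_quot) : bool :=
  `[< exists b : alg_quot, b * a = 1 /\ a * b = 1 >].

Definition quot_inv (a : alg_quot) : alg_quot :=
  if pselect (exists b : alg_quot, b * a = 1 /\ a * b = 1) is left ex
  then projT1 (cid ex) else a.

Fact quot_invP a : quot_unit a -> quot_inv a * a = 1 /\ a * quot_inv a = 1.
Proof.
move=> /asboolP ua; rewrite /quot_inv; case: pselect => // ex.
by case: (cid ex).
Qed.

Fact quot_mulVr : {in quot_unit, left_inverse 1 quot_inv *%R}.
Proof. by move=> a /quot_invP[]. Qed.
Fact quot_mulrV : {in quot_unit, right_inverse 1 quot_inv *%R}.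
Proof. by move=> a /quot_invP[]. Qed.
Fact quot_unitP (a b : alg_quot) : b * a = 1 /\ a * b = 1 -> quot_unit a.
Proof. by move=> ab; apply/asboolP; exists b. Qed.
Fact quot_invr_out : {in [predC quot_unit], quot_inv =1 id}.
Proof.
by move=> a /asboolPn nua; rewrite /quot_inv; case: pselect.
Qed.

HB.instance Definition _ := GRing.NzRing_hasMulInverse.Build alg_quot
  quot_mulVr quot_mulrV quot_unitP quot_invr_out.

Fact quot_pi_zmod : zmod_morphism quot_pi.
Proof.
by move=> x y; rewrite -[RHS]/(quot_add _ (quot_opp _)) quot_piN quot_piD.
Qed.
HB.instance Definition _ :=
  GRing.isZmodMorphism.Build F alg_quot quot_pi quot_pi_zmod.
Fact quot_pi_monoid : monoid_morphism quot_pi.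
Proof.
split=> [|x y]; first by rewrite -[RHS]/quot_one quot_pi1.
by rewrite -[RHS]/(quot_mul _ _) quot_piM.
Qed.
HB.instance Definition _ :=
  GRing.isMonoidMorphism.Build F alg_quot quot_pi quot_pi_monoid.
Fact quot_pi_scalable : scalable quot_pi.
Proof. by move=> c x; rewrite -[RHS]/(quot_scale _ _) quot_piZ. Qed.
HB.instance Definition _ :=
  GRing.isScalable.Build K F alg_quot *:%R quot_pi quot_pi_scalable.

Lemma quot_lift (A : algType K) (f : {lrmorphism F -> A}) :
    (forall x, J x -> f x = 0) ->
  exists g : {lrmorphism alg_quot -> A}, forall x, g (quot_pi x) = f x.
Proof.
move=> fJ; pose g (a : alg_quot) := f (repr a).
have gE x : g (quot_pi x) = f x.
  by apply/eqP; rewrite -subr_eq0 /g -rmorphB; apply/eqP/fJ/J_repr.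
have g_zmod : zmod_morphism g.
  elim/quot_ind=> x; elim/quot_ind=> y.
  by rewrite -rmorphB !gE rmorphB.
have g_monoid : monoid_morphism g.
  split=> [|]; first by rewrite -(rmorph1 quot_pi) gE rmorph1.
  elim/quot_ind=> x; elim/quot_ind=> y.
  by rewrite -rmorphM !gE rmorphM.
have g_scal : scalable g.
  move=> c; elim/quot_ind=> x.
  by rewrite -linearZ !gE linearZ.
pose gz := GRing.isZmodMorphism.Build _ _ g g_zmod.
pose gm := GRing.isMonoidMorphism.Build _ _ g g_monoid.
pose gs := GRing.isScalable.Build K _ _ *:%R g g_scal.
pose G : {lrmorphism alg_quot -> A} := HB.pack g gz gm gs.
by exists G.
Qed.

End QuotientAlgebra.

Section FreeAlgebra.
Variables (K : fieldType) (I : choiceType).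

Definition free_alg := {malg K[{fmonom I}]}.
HB.instance Definition _ := GRing.Lalgebra.on free_alg.

Definition free_gen (i : I) : free_alg := << fmu i >>.

Fact free_malgC_comm (k : K) (x : free_alg) : k%:MP * x = x * k%:MP.
Proof.
rewrite [x]monalgE mulr_sumr mulr_suml; apply: eq_bigr => m _.
by rewrite !malgM_def !fgmulUU mul1m mulm1 mulrC.
Qed.

Fact free_scalerAr (k : K) (x y : free_alg) : k *: (x * y) = x * (k *: y).
Proof. by rewrite -[LHS]mul_malgC -[k *: y]mul_malgC !mulrA free_malgC_comm. Qed.

HB.instance Definition _ :=
  GRing.Lalgebra_isAlgebra.Build K free_alg free_scalerAr.

Section Eval.
Variables (A : algType K) (t : I -> A).

Definition word_eval (m : {fmonom I}) : A := \prod_(i <- (m : seq I)) t i.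

Fact word_eval_mmorphism : mmorphism word_eval.
Proof.
split=> [m1 m2|]; rewrite /word_eval; first by rewrite fmM big_cat.
by rewrite fm1 big_nil.
Qed.

HB.instance Definition _ :=
  monalg.isMultiplicative.Build {fmonom I} A word_eval word_eval_mmorphism.

Definition free_eval : free_alg -> A := mmap (in_alg A) word_eval.

HB.instance Definition _ :=
  GRing.isZmodMorphism.Build free_alg A free_eval (@mmap_is_additive _ _ _ _ _).

Fact free_eval_monoid : monoid_morphism free_eval.
Proof.
have [|fM f1] := @commr_mmap_is_multiplicative _ _ _ (in_alg A) word_eval.
  move=> g m m'; rewrite /GRing.comm /=.
  by rewrite -scalerAl mul1r -scalerAr mulr1.
by split.
Qed.

HB.instance Definition _ :=
  GRing.isMonoidMorphism.Build free_alg A free_eval free_eval_monoid.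

Fact free_eval_scalable : scalable free_eval.
Proof. by move=> c x; rewrite /free_eval mmapZ /= -scalerAl mul1r. Qed.

HB.instance Definition _ :=
  GRing.isScalable.Build K free_alg A *:%R free_eval free_eval_scalable.

Lemma free_eval_gen i : free_eval (free_gen i) = t i.
Proof.
by rewrite /free_eval /free_gen mmapU /= scale1r mul1r /word_eval fmU big_seq1.
Qed.
End Eval.

Lemma free_ind (P : free_alg -> Prop) :
    P 1 -> (forall a x y, P x -> P y -> P (a *: x + y)) ->
    (forall i x, P x -> P (free_gen i * x)) -> forall x, P x.
Proof.
move=> P1 PD PM x.
have P0 : P 0 by rewrite -(subrr 1) addrC -scaleN1r; apply: PD.
rewrite [x]monalgE; elim/big_rec: _ => //= m y _ Py.
have -> : << x@_m *g m >> = x@_m *: (<< m >> : free_alg).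
  by rewrite -[RHS]mul_malgC malgM_def fgmulUU mul1m mulr1.
apply: PD => //; case: m => s; elim: s => [|i s IH].
  by rewrite -[FMonom [::]]fmoneE.
have -> : << FMonom (i :: s) >> = free_gen i * << FMonom s >> :> free_alg.
  rewrite /free_gen malgM_def fgmulUU mulr1; congr << _ >>.
  by rewrite /mmul /= fmmulE fmuE.
exact: PM.
Qed.
End FreeAlgebra.
Arguments free_gen {K I} i.

Section RelIdeal.
Variables (K : fieldType) (F : algType K) (E : F -> F -> Prop).

(* The two-sided ideal generated by the differences x - y with E x y. *)
Inductive rel_ideal : F -> Prop :=
| rel_ideal_gen x y : E x y -> rel_ideal (x - y)
| rel_ideal_0 : rel_ideal 0
| rel_ideal_D x y : rel_ideal x -> rel_ideal y -> rel_ideal (x + y)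
| rel_ideal_mull a x : rel_ideal x -> rel_ideal (a * x)
| rel_ideal_mulr a x : rel_ideal x -> rel_ideal (x * a).

Lemma rel_ideal_morph (A : algType K) (f : {lrmorphism F -> A}) :
  (forall x y, E x y -> f x = f y) -> forall x, rel_ideal x -> f x = 0.
Proof.
move=> fE x; elim=> {x} [x y /fE|| x y _ + _|a x _|a x _].
- by rewrite rmorphB /= => ->; rewrite subrr.
- by rewrite rmorph0.
- by rewrite rmorphD /= => -> ->; rewrite addr0.
- by rewrite rmorphM /= => ->; rewrite mulr0.
- by rewrite rmorphM /= => ->; rewrite mul0r.
Qed.

Lemma rel_ideal_proper (A : algType K) (f : {lrmorphism F -> A}) :
  (forall x y, E x y -> f x = f y) -> ~ rel_ideal 1.
Proof. by move=> fE /(rel_ideal_morph fE)/eqP; rewrite rmorph1 oner_eq0. Qed.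

Definition gen_ideal2 (E1 : ~ rel_ideal 1) : proper_ideal2 F :=
  ProperIdeal2 rel_ideal_0 rel_ideal_D rel_ideal_mull rel_ideal_mulr E1.
End RelIdeal.

Section GeneratedSubalgebra.
Local Open Scope classical_set_scope.
Variables (K : fieldType) (A : algType K).

Definition gen_subalg (G : set A) : set A :=
  smallest (fun S : set A => GRing.subalg_closed [in S]) G.
End GeneratedSubalgebra.

Section HeckeRelations.
Variables (K : fieldType) (n : nat) (q : K) (A : algType K).

(* Indices are shifted: T i, for i : 'I_n, is the generator T_(i+1), so that
   T_1 (or X) is the T i with i = 0. *)
Inductive braid_rel (T : 'I_n -> A) : A -> A -> Prop :=
| braid_far (i j : 'I_n) : (i.+1 < j)%N || (j.+1 < i)%N ->
    braid_rel T (T i * T j) (T j * T i)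
| braid3 (i j : 'I_n) : (0 < i)%N -> j = i.+1 :> nat ->
    braid_rel T (T i * T j * T i) (T j * T i * T j)
| braid4 (i j : 'I_n) : i = 0%N :> nat -> j = 1%N :> nat ->
    braid_rel T (T i * T j * T i * T j) (T j * T i * T j * T i)
| braid_quad (i : 'I_n) : (0 < i)%N ->
    braid_rel T ((T i - 1) * (T i + q%:A)) 0.

Inductive cyclotomic_rel (r : nat) (u : 'I_r -> K) (T : 'I_n -> A) :
    A -> A -> Prop :=
| cyclotomic_braid x y : braid_rel T x y -> cyclotomic_rel u T x y
| cyclotomic_order (i : 'I_n) : i = 0%N :> nat ->
    cyclotomic_rel u T (\prod_(j < r) (T i - (u j)%:A)) 0.

(* None is the inverse of the generator X = Some 0. *)
Inductive affine_rel (T : option 'I_n -> A) : A -> A -> Prop :=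
| affine_braid x y : braid_rel (fun i => T (Some i)) x y -> affine_rel T x y
| affine_invl (i : 'I_n) : i = 0%N :> nat -> affine_rel T (T None * T (Some i)) 1
| affine_invr (i : 'I_n) : i = 0%N :> nat -> affine_rel T (T (Some i) * T None) 1.
End HeckeRelations.

Section HeckeRelationsMorph.
Variables (K : fieldType) (n : nat) (q : K) (A B : algType K).
Variable f : {lrmorphism A -> B}.

Lemma braid_rel_morph (T : 'I_n -> A) x y :
  braid_rel q T x y -> braid_rel q (f \o T) (f x) (f y).
Proof.
case=> [i j ij|i j i0 ij|i j i0 j1|i i0]; rewrite ?rmorph0 !rmorphM.
- exact: (@braid_far _ _ q _ (f \o T)).
- exact: (@braid3 _ _ q _ (f \o T)).
- exact: (@braid4 _ _ q _ (f \o T)).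
rewrite rmorphB rmorphD /= linearZ /= !rmorph1.
exact: (@braid_quad _ _ q _ (f \o T)).
Qed.

Lemma cyclotomic_rel_morph (r : nat) (u : 'I_r -> K) (T : 'I_n -> A) x y :
  cyclotomic_rel q u T x y -> cyclotomic_rel q u (f \o T) (f x) (f y).
Proof.
case=> [{}x {}y /braid_rel_morph|i i0]; first exact: cyclotomic_braid.
rewrite rmorph0 rmorph_prod; under eq_bigr do rewrite rmorphB /= linearZ /= rmorph1.
exact: (@cyclotomic_order _ _ q _ _ u (f \o T)).
Qed.

Lemma affine_rel_morph (T : option 'I_n -> A) x y :
  affine_rel q T x y -> affine_rel q (f \o T) (f x) (f y).
Proof.
case=> [{}x {}y /braid_rel_morph bxy|i i0|i i0]; first exact: affine_braid.
  by rewrite rmorphM rmorph1; apply: (@affine_invl _ _ q _ (f \o T)).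
by rewrite rmorphM rmorph1; apply: (@affine_invr _ _ q _ (f \o T)).
Qed.

Lemma braid_rel_lift (T : 'I_n -> A) x y : braid_rel q (f \o T) x y ->
  exists x' y', [/\ braid_rel q T x' y', x = f x' & y = f y'].
Proof.
case=> [i j ij|i j i0 ij|i j i0 j1|i i0] /=; rewrite -?rmorphM.
- by do 2!eexists; split=> //; apply: braid_far.
- by do 2!eexists; split=> //; apply: braid3.
- by do 2!eexists; split=> //; apply: braid4.
exists ((T i - 1) * (T i + q%:A)), 0; split; first exact: braid_quad.
  by rewrite rmorphM rmorphB rmorphD /= linearZ /= !rmorph1.
by rewrite rmorph0.
Qed.

Lemma cyclotomic_rel_lift (r : nat) (u : 'I_r -> K) (T : 'I_n -> A) x y :
    cyclotomic_rel q u (f \o T) x y ->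
  exists x' y', [/\ cyclotomic_rel q u T x' y', x = f x' & y = f y'].
Proof.
case=> [{}x {}y /braid_rel_lift[x' [y' [bxy -> ->]]]|i i0].
  by exists x', y'; split=> //; apply: cyclotomic_braid.
exists (\prod_(j < r) (T i - (u j)%:A)), 0.
split; rewrite ?rmorph0 //; first exact: cyclotomic_order.
rewrite rmorph_prod; apply: eq_bigr => j _.
by rewrite rmorphB /= rmorph_alg.
Qed.

Lemma affine_rel_lift (T : option 'I_n -> A) x y : affine_rel q (f \o T) x y ->
  exists x' y', [/\ affine_rel q T x' y', x = f x' & y = f y'].
Proof.
case=> [{}x {}y /(@braid_rel_lift (fun i => T (Some i)))|i i0|i i0].
- move=> [x' [y' [bxy -> ->]]].
  by exists x', y'; split=> //; apply: affine_braid.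
- exists (T None * T (Some i)), 1.
  by split; rewrite ?rmorphM ?rmorph1 //; apply: affine_invl.
exists (T (Some i) * T None), 1.
by split; rewrite ?rmorphM ?rmorph1 //; apply: affine_invr.
Qed.
End HeckeRelationsMorph.

(* One-dimensional representations, showing that the presented algebras are
   not zero. *)
Section Characters.
Variables (K : fieldType) (n : nat) (q : K).

Definition hecke_char (c : K) (i : 'I_n) : K^o := if i == 0%N :> nat then c else 1.

Fact braid_rel_char c x y : braid_rel q (hecke_char c) x y -> x = y.
Proof.
case=> [i j _|i j i0 ij|i j _ _|i i0].
- exact: mulrC.
- by rewrite /hecke_char ij /= !eqn0Ngt i0 /= !mulr1.
- by rewrite (mulrC (hecke_char c i)) mulrAC.
by rewrite /hecke_char eqn0Ngt i0 /= subrr mul0r.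
Qed.

Fact cyclotomic_proper (r : nat) (hr : (0 < r)%N) (u : 'I_r -> K) :
  ~ rel_ideal (cyclotomic_rel q u (@free_gen K 'I_n)) 1.
Proof.
case: r hr u => // r _ u.
pose t := hecke_char (u ord0).
apply: (@rel_ideal_proper _ _ _ _ (free_eval t)) => x y.
move=> /(cyclotomic_rel_morph (free_eval t)).
have -> : free_eval t \o free_gen = t.
  by apply/funext => i /=; rewrite free_eval_gen.
case=> {x y} [_ _ /braid_rel_char //|i i0].
by rewrite big_ord_recl {1}/t /hecke_char i0 /= [_ *: _]mulr1 subrr mul0r.
Qed.

Fact affine_proper : ~ rel_ideal (affine_rel q (@free_gen K (option 'I_n))) 1.
Proof.
pose t o : K^o := if o is Some i then hecke_char 1 i else 1.
apply: (@rel_ideal_proper _ _ _ _ (free_eval t)) => x y.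
move=> /(affine_rel_morph (free_eval t)).
have -> : free_eval t \o free_gen = t.
  by apply/funext => i /=; rewrite free_eval_gen.
case=> {x y} [_ _ /braid_rel_char //|i i0|i i0];
  by rewrite /t /hecke_char i0 mulr1.
Qed.
End Characters.

Section HeckeAlgebras.
Variables (K : fieldType) (n : nat).

Section Cyclotomic.
Variables (r : nat) (hr : (0 < r)%N) (u : 'I_r -> K) (q : K).

Definition hecke := alg_quot (gen_ideal2 (@cyclotomic_proper K n q r hr u)).

Definition hecke_T (i : 'I_n) : hecke := quot_pi _ (free_gen i).

Lemma hecke_relP x y : cyclotomic_rel q u hecke_T x y -> x = y.
Proof.
move=> /(@cyclotomic_rel_lift _ _ _ _ _ (quot_pi _))[x' [y' [r' -> ->]]].
by apply/quot_piP; apply: rel_ideal_gen.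
Qed.

Lemma hecke_lift (A : algType K) (T : 'I_n -> A) :
    (forall x y, cyclotomic_rel q u T x y -> x = y) ->
  exists f : {lrmorphism hecke -> A}, forall i, f (hecke_T i) = T i.
Proof.
move=> TP; have [|f fE] := @quot_lift _ _
    (gen_ideal2 (@cyclotomic_proper K n q r hr u)) A (free_eval T).
  apply: rel_ideal_morph => x y /(cyclotomic_rel_morph (free_eval T)) rxy.
  have E : free_eval T \o free_gen = T.
    by apply/funext => i /=; rewrite free_eval_gen.
  by apply: TP; rewrite E in rxy.
by exists f => i; rewrite fE /= free_eval_gen.
Qed.

Lemma hecke_ind (P : hecke -> Prop) :
    P 1 -> (forall a x y, P x -> P y -> P (a *: x + y)) ->
    (forall i x, P x -> P (hecke_T i * x)) -> forall x, P x.
Proof.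
move=> P1 PD PM; elim/quot_ind; apply: free_ind => [|a x y Px Py|i x Px].
- by rewrite rmorph1.
- by rewrite linearP; apply: PD.
by rewrite rmorphM; apply: PM.
Qed.

(* When all u j are nonzero, T_1 is a unit and ^-1 below is its inverse; on
   non-units ^-1 is the identity. *)
Inductive hecke_sub_gen (p : nat) : hecke -> Prop :=
| hecke_t0 (i : 'I_n) : i = 0%N :> nat -> hecke_sub_gen p (hecke_T i ^+ p)
| hecke_t1 (i j : 'I_n) : i = 0%N :> nat -> j = 1%N :> nat ->
    hecke_sub_gen p ((hecke_T i)^-1 * hecke_T j * hecke_T i)
| hecke_ti (i : 'I_n) : (0 < i)%N -> hecke_sub_gen p (hecke_T i).

Definition hecke_sub (p : nat) : set hecke := gen_subalg (hecke_sub_gen p).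
End Cyclotomic.

Section Affine.
Variable q : K.

Definition affine_hecke := alg_quot (gen_ideal2 (@affine_proper K n q)).

Definition affine_T (i : 'I_n) : affine_hecke := quot_pi _ (free_gen (Some i)).
Definition affine_Xinv : affine_hecke := quot_pi _ (free_gen None).

Definition affine_gen (o : option 'I_n) : affine_hecke :=
  if o is Some i then affine_T i else affine_Xinv.

Lemma affine_relP x y : affine_rel q affine_gen x y -> x = y.
Proof.
have -> : affine_gen = quot_pi _ \o free_gen by apply/funext => -[i|].
move=> /(@affine_rel_lift _ _ _ _ _ (quot_pi _))[x' [y' [r' -> ->]]].
by apply/quot_piP; apply: rel_ideal_gen.
Qed.

Lemma affine_lift (A : algType K) (T : option 'I_n -> A) :
    (forall x y, affine_rel q T x y -> x = y) ->
  exists f : {lrmorphism affine_hecke -> A}, forall o, f (affine_gen o) = T o.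
Proof.
move=> TP; have [|f fE] := @quot_lift _ _
    (gen_ideal2 (@affine_proper K n q)) A (free_eval T).
  apply: rel_ideal_morph => x y /(affine_rel_morph (free_eval T)) rxy.
  have E : free_eval T \o free_gen = T.
    by apply/funext => i /=; rewrite free_eval_gen.
  by apply: TP; rewrite E in rxy.
by exists f => -[i|] /=; rewrite fE /= free_eval_gen.
Qed.

Lemma affine_XinvE (i : 'I_n) : i = 0%N :> nat ->
  affine_T i \is a GRing.unit /\ affine_Xinv = (affine_T i)^-1.
Proof.
move=> i0.
have Vl : affine_Xinv * affine_T i = 1.
  by apply: affine_relP; apply: (@affine_invl _ _ _ _ affine_gen).
have Vr : affine_T i * affine_Xinv = 1.
  by apply: affine_relP; apply: (@affine_invr _ _ _ _ affine_gen).
have uX : affine_T i \is a GRing.unit by apply/unitrP; exists affine_Xinv.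
by split=> //; apply: (mulrI uX); rewrite Vr mulrV.
Qed.

Lemma affine_ind (P : affine_hecke -> Prop) :
    P 1 -> (forall a x y, P x -> P y -> P (a *: x + y)) ->
    (forall o x, P x -> P (affine_gen o * x)) -> forall x, P x.
Proof.
move=> P1 PD PM; elim/quot_ind; apply: free_ind => [|a x y Px Py|[i|] x Px].
- by rewrite rmorph1.
- by rewrite linearP; apply: PD.
- by rewrite rmorphM; apply: (PM (Some i)).
by rewrite rmorphM; apply: (PM None).
Qed.

Inductive affine_sub_gen (p : nat) : affine_hecke -> Prop :=
| affine_Xp (i : 'I_n) : i = 0%N :> nat -> affine_sub_gen p (affine_T i ^+ p)
| affine_XNp (i : 'I_n) : i = 0%N :> nat -> affine_sub_gen p (affine_T i ^- p)
| affine_t1 (i j : 'I_n) : i = 0%N :> nat -> j = 1%N :> nat ->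
    affine_sub_gen p ((affine_T i)^-1 * affine_T j * affine_T i)
| affine_ti (i : 'I_n) : (0 < i)%N -> affine_sub_gen p (affine_T i).

Definition affine_sub (p : nat) : set affine_hecke :=
  gen_subalg (affine_sub_gen p).
End Affine.
End HeckeAlgebras.
Arguments hecke {K} n {r} hr u q.
Arguments hecke_T {K n r} hr u q i.
Arguments hecke_sub {K} n {r} hr u q p _.
Arguments affine_hecke {K} n q.
Arguments affine_T {K n} q i.
Arguments affine_sub {K} n q p _.

(* The family obtained from T by multiplying T_1 by xi. *)
Definition twist (K : fieldType) (n : nat) (xi : K) (A : lmodType K)
    (T : 'I_n -> A) (i : 'I_n) : A :=
  if i == 0%N :> nat then xi *: T i else T i.

(* Main.v *)
(* The relation (T_1 - u_1)...(T_1 - u_r) = 0 is a polynomial relation in T_1^p with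
   nonzero constant term, so tau exists, T_1 is invertible and T_1^-p lies in
   B = H_{r,p,n}.  From T_1 T_2 T_1 T_2 = T_2 T_1 T_2 T_1 one gets
   T_1 t_2 T_1^-1 = t_2^-1 t_1 t_2, so B is stable under x |-> T_1 x T_1^-1.  This makes
   the sum of tau^a(x), 0 <= a < p, an element of B for every x; when x is fixed that
   sum is p x. *)
Require Import Defs.
From mathcomp Require Import all_boot all_fingroup all_algebra.
From mathcomp Require Import boolp classical_sets reals complex.

Set Implicit Arguments.
Unset Strict Implicit.
Unset Printing Implicit Defensive.

Import GRing.Theory.
Local Open Scope ring_scope.
Local Open Scope complex_scope.

(** * Closure properties of generated subalgebras *)

(** Passes between boolean membership [[in S]], on which [gen_subalg] is built, and the proposition
    [S x]. *)
Lemma subalg_setP (K : fieldType) (A : algType K) (S : set A) :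
  GRing.subalg_closed [in S] <->
  [/\ S 1, forall c x y, S x -> S y -> S (c *: x + y)
     & forall x y, S x -> S y -> S (x * y)].
Proof.
split=> [[S1 SD SM]|[S1 SD SM]]; split=> [|c x y Sx Sy|x y Sx Sy].
- exact: set_mem.
- by apply/set_mem/SD; apply/mem_set.
- by apply/set_mem/SM; apply/mem_set.
- exact/mem_set.
- by apply/mem_set; apply: SD; apply: set_mem.
- by apply/mem_set; apply: SM; apply: set_mem.
Qed.

Section Subalgebras.
Variables (K : fieldType) (A : algType K).
Implicit Types (S G : set A).

Lemma gen_subalg_closed G : GRing.subalg_closed [in gen_subalg G].
Proof.
apply/subalg_setP.
split=> [|c x y Gx Gy|x y Gx Gy] S [/[dup] cS /subalg_setP[S1 SD SM] GS] //.
- by apply: SD; [apply: Gx|apply: Gy].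
- by apply: SM; [apply: Gx|apply: Gy].
Qed.

(** Powers, scalar multiples and, in [poly_inv], inverses are all obtained as values of
    polynomials. *)
Lemma gen_subalg_horner G a (f : {poly K}) :
  gen_subalg G a -> gen_subalg G (horner_alg a f).
Proof.
have /subalg_setP[G1 GD GM] := gen_subalg_closed G; move=> Ga.
elim/poly_ind: f => [|f c IH].
  by rewrite rmorph0 -(subrr 1) addrC -scaleN1r; apply: GD.
rewrite rmorphD rmorphM /= horner_algX horner_algC addrC.
by apply: GD => //; apply: GM.
Qed.

Lemma gen_subalgX G a k : gen_subalg G a -> gen_subalg G (a ^+ k).
Proof.
by move=> Ga; rewrite -[a](horner_algX a) -rmorphXn; apply: gen_subalg_horner.
Qed.

Lemma gen_subalgZ G c a : gen_subalg G a -> gen_subalg G (c *: a).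
Proof.
by move=> /(@gen_subalg_horner _ _ (c *: 'X)); rewrite linearZ /= horner_algX mulr_algl.
Qed.

(** With [g] the identity this is the fixed subalgebra of [f], so fixedness of a generated
    subalgebra can be checked on generators. *)
Lemma fixed_subalg (B : algType K) (f g : {lrmorphism A -> B}) :
  GRing.subalg_closed [in [set x | f x = g x]%classic].
Proof.
apply/subalg_setP; split=> /= [|c x y fx fy|x y fx fy].
- by rewrite !rmorph1.
- by rewrite !linearP /= fx fy.
- by rewrite !rmorphM /= fx fy.
Qed.

Lemma preimage_subalg (B : algType K) (f : {lrmorphism A -> B}) (S : set B) :
  GRing.subalg_closed [in S] -> GRing.subalg_closed [in (f @^-1` S)%classic].
Proof.
move=> /subalg_setP[S1 SD SM]; apply/subalg_setP; rewrite /preimage /=.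
split=> [|c x y Sx Sy|x y Sx Sy].
- by rewrite rmorph1.
- by rewrite linearP; apply: SD.
- by rewrite rmorphM; apply: SM.
Qed.
End Subalgebras.

(** * Inverses and conjugation *)

Section SubalgebraUnits.
Variables (K : fieldType) (A : unitAlgType K).

(* If f(a) = 0 and f = g X + f(0), then - g(a) / f(0) is inverse to a. *)
Lemma poly_inv (G : set A) a (f : {poly K}) :
    horner_alg a f = 0 -> f.[0] != 0 -> gen_subalg G a ->
  a \is a GRing.unit /\ gen_subalg G a^-1.
Proof.
move=> fa f0 Ga.
have [g fE] : exists g, f - (f.[0])%:P = g * 'X.
  have /factor_theorem[g] : root (f - (f.[0])%:P) 0.
    by rewrite /root hornerD hornerN hornerC subrr.
  by rewrite subr0; exists g.
pose b := horner_alg a (- (f.[0])^-1 *: g).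
have bX : - (f.[0])^-1 *: g * 'X = 1 - (f.[0])^-1 *: f.
  rewrite -scalerAl -fE scalerBr !scaleNr opprK addrC; congr (_ - _).
  by rewrite -mul_polyC -polyCM mulVf.
have ba : b * a = 1.
  rewrite /b -{2}[a](horner_algX a) -rmorphM bX.
  by rewrite rmorphB rmorph1 /= linearZ /= fa mulr0 subr0.
have ab : a * b = 1.
  rewrite /b -{1}[a](horner_algX a) -rmorphM mulrC bX.
  by rewrite rmorphB rmorph1 /= linearZ /= fa mulr0 subr0.
have ua : a \is a GRing.unit by apply/unitrP; exists b.
split=> //; have -> : a^-1 = b by apply: (mulrI ua); rewrite mulrV.
exact: gen_subalg_horner.
Qed.

(** Conjugation by a unit is multiplicative, so stability of a generated subalgebra under it can be
    checked on generators. *)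
Lemma conj_subalg (S : set A) (t : A) : t \is a GRing.unit ->
  GRing.subalg_closed [in S] ->
  GRing.subalg_closed [in [set x | S (t * x * t^-1)]%classic].
Proof.
move=> ut /subalg_setP[S1 SD SM]; apply/subalg_setP.
split=> /= [|c x y Sx Sy|x y Sx Sy].
- by rewrite mulr1 mulrV.
- by rewrite mulrDr mulrDl -scalerAr -scalerAl; apply: SD.
- have -> : t * (x * y) * t^-1 = (t * x * t^-1) * (t * y * t^-1).
    by rewrite !mulrA mulrVK.
  exact: SM.
Qed.
End SubalgebraUnits.

(** Clearing the three inverses turns the claim into the braid relation of length 4. With t = T_1
    and s = T_2 the right side is T_2^-1 t_1 T_2. *)
Lemma braid4_conj (A : unitRingType) (s t : A) :
    s \is a GRing.unit -> t \is a GRing.unit ->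
  t * s * t * s = s * t * s * t -> t * s * t^-1 = s^-1 * (t^-1 * s * t) * s.
Proof.
move=> us ut E; apply: (mulrI us); rewrite !mulrA mulrV // mul1r.
apply: (mulrI ut); rewrite !mulrA mulrV // mul1r; apply: (mulIr ut).
by rewrite mulrVK.
Qed.

(** * Rescaling the first generator *)

Lemma twistE (K : fieldType) n (A : lmodType K) c (T : 'I_n -> A) i :
  twist c T i = (if i == 0%N :> nat then c else 1) *: T i.
Proof. by rewrite /twist; case: ifP; rewrite ?scale1r. Qed.

Section Twist.
Variables (K : fieldType) (n : nat) (A : algType K).
Implicit Types (T : 'I_n -> A) (c : K).

(** The commutation and length 4 relations have equal degree in T_1 on both sides, so the powers of
    c agree; the other two families do not involve T_1. *)
Lemma braid_rel_twist q c T :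
    (forall x y, braid_rel q T x y -> x = y) ->
  forall x y, braid_rel q (twist c T) x y -> x = y.
Proof.
move=> TP _ _ [i j ij|i j i0 ij|i j i0 j1|i i0].
- have E := TP _ _ (@braid_far _ _ q _ T i j ij).
  by rewrite !twistE -!scalerAl -!scalerAr !scalerA E; congr (_ *: _); apply: mulrC.
- rewrite /twist ij /= eqn0Ngt i0 /=; exact: TP (@braid3 _ _ q _ T i j i0 ij).
- have E := TP _ _ (@braid4 _ _ q _ T i j i0 j1).
  by rewrite /twist i0 j1 /= -!(scalerAl, scalerAr, mulrA) !mulrA E.
- by rewrite /twist eqn0Ngt i0 /=; exact: TP (@braid_quad _ _ q _ T i i0).
Qed.

Lemma twist1 T i : twist 1 T i = T i.
Proof. by rewrite twistE if_same scale1r. Qed.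

Lemma twistM c d T i : twist c (twist d T) i = twist (c * d) T i.
Proof. by rewrite !twistE scalerA; case: ifP; rewrite ?mulr1. Qed.

Lemma twist_morph (B : algType K) (f : {lrmorphism A -> B}) c T i :
  f (twist c T i) = twist c (f \o T) i.
Proof. by rewrite !twistE linearZ. Qed.

End Twist.

(** * The order relation as a polynomial in T_1^p *)

Section HornerAlg.
Variables (K : fieldType) (A : algType K).

Lemma horner_alg_prod r (u : 'I_r -> K) (t : A) :
  horner_alg t (\prod_(j < r) ('X - (u j)%:P)) = \prod_(j < r) (t - (u j)%:A).
Proof.
rewrite rmorph_prod; apply: eq_bigr => j _.
by rewrite rmorphB /= horner_algX horner_algC.
Qed.

Lemma horner_alg_comp_Xn (f : {poly K}) p (t : A) :
  horner_alg t (f \Po 'X^p) = horner_alg (t ^+ p) f.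
Proof.
elim/poly_ind: f => [|f c IH]; first by rewrite comp_poly0 !rmorph0.
rewrite comp_poly_MXaddC !rmorphD !rmorphM /= IH !horner_algC horner_algX.
by rewrite rmorphXn /= horner_algX.
Qed.
End HornerAlg.

Lemma prod_sub_prim_root (F : fieldType) p (z w : F) :
    p.-primitive_root z ->
  \prod_(k < p) ('X - (z ^+ k * w)%:P) = 'X^p - (w ^+ p)%:P.
Proof.
move=> zP; have p0 := prim_order_gt0 zP.
have [->|w0] := eqVneq w 0.
  rewrite expr0n gtn_eqF // mulr0n subr0.
  under eq_bigr do rewrite mulr0 subr0.
  by rewrite prodr_const card_ord.
(* Substitute X/w in the factorization of X^p - 1 and multiply by w^p, giving one factor w to each
   of the p linear factors. *)
have := congr1 (fun f => w ^+ p *: (f \Po (w^-1 *: 'X))) (factor_Xn_sub_1 zP).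
rewrite big_mkord rmorph_prod /= -{1}[p]card_ord -prodr_const -scaler_prod.
rewrite rmorphB rmorphXn rmorph1 /= comp_polyX exprZn scalerBr scalerA exprVn.
rewrite mulfV ?expf_neq0 // scale1r.
rewrite alg_polyC => <-; apply: eq_bigr => k _.
rewrite rmorphB /= comp_polyX comp_polyC scalerBr scalerA mulfV // scale1r.
by rewrite -mul_polyC -polyCM mulrC.
Qed.

Lemma prod_block (R : comPzRingType) r p (f : 'I_r -> R)
    (g : 'I_(r %/ p) -> 'I_p -> R) : (p %| r)%N ->
    (forall (j : 'I_r) (l : 'I_(r %/ p)) (k : 'I_p),
       j = (l * p + k)%N :> nat -> f j = g l k) ->
  (* For p = 0 divisibility forces r = 0 and both outer products are empty; otherwise j corresponds
     to (j div p, j mod p). *)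
  \prod_j f j = \prod_l \prod_k g l k.
Proof.
move=> pr fg; have [p0|p0] := posnP p.
  have {}p0 : r = 0%N by move: pr; rewrite p0 dvd0n => /eqP.
  subst r; rewrite big_ord0 big1 // => -[l /= lt_l].
  by exfalso; move: lt_l; rewrite div0n.
have rE : (r %/ p * p)%N = r by rewrite divnK.
have lt (x : 'I_(r %/ p) * 'I_p) : (x.1 * p + x.2 < r)%N.
  apply: leq_trans (_ : _ < r %/ p * p)%N _; last by rewrite rE.
  by rewrite -ltn_divLR // divnMDl // (divn_small (ltn_ord x.2)) addn0.
rewrite pair_bigA /= (reindex (fun x => Ordinal (lt x))).
  by apply: eq_bigr => x _; apply: fg.
have ltd (j : 'I_r) : (j %/ p < r %/ p)%N by rewrite ltn_divLR // rE.
exists (fun j => (Ordinal (ltd j), Ordinal (ltn_pmod j p0))) => [[l k] _|j _].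
  congr pair; apply: val_inj; rewrite /= ?modnMDl ?modn_small //.
  by rewrite divnMDl // (divn_small (ltn_ord k)) addn0.
by apply: val_inj; rewrite /= -divn_eq.
Qed.

(** * The cyclotomic algebra, tau and the subalgebra B *)

Section Cyclotomic.
Variables (K : fieldType) (n r p : nat) (hr : (0 < r)%N) (u : 'I_r -> K) (q : K).
(** In the theorem [f] is the product of the X - v_l^p; here it enters through [uE] and, later,
    through its nonzero constant term. *)
Variable f : {poly K}.
Hypothesis p_gt0 : (0 < p)%N.
Hypothesis uE : \prod_(j < r) ('X - (u j)%:P) = f \Po 'X^p.

Notation H := (hecke n hr u q).
Notation T := (hecke_T hr u q : 'I_n -> H).
Notation S := (@hecke_sub_gen K n r hr u q p).
Notation B := (hecke_sub n hr u q p).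

Lemma hecke_hom_ext (A : algType K) (g h : {lrmorphism H -> A}) :
  (forall i, g (T i) = h (T i)) -> g =1 h.
Proof.
move=> gh; apply: hecke_ind => [|a x y gx gy|i x gx].
- by rewrite !rmorph1.
- by rewrite !linearP /= gx gy.
- by rewrite !rmorphM /= gh gx.
Qed.

Lemma horner_hecke_T (i : 'I_n) : i = 0%N :> nat -> horner_alg (T i ^+ p) f = 0.
Proof.
move=> i0; rewrite -horner_alg_comp_Xn -uE horner_alg_prod.
by apply: hecke_relP; apply: cyclotomic_order.
Qed.

(** The order relation reads f(T_1^p) = 0, and T_1^p is unchanged when T_1 is multiplied by c with
    c^p = 1. *)
Lemma hecke_twist c : c ^+ p = 1 ->
  exists g : {lrmorphism H -> H}, forall i, g (T i) = twist c T i.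
Proof.
move=> cp; apply: hecke_lift => x y [{}x {}y|i i0].
  by apply: braid_rel_twist => {}x {}y xy; apply/hecke_relP/cyclotomic_braid.
rewrite -horner_alg_prod uE horner_alg_comp_Xn /twist i0 exprZn cp scale1r.
exact: horner_hecke_T.
Qed.

Lemma hecke_twist_comp c d (g h k : {lrmorphism H -> H}) :
    (forall i, g (T i) = twist c T i) -> (forall i, h (T i) = twist d T i) ->
    (forall i, k (T i) = twist (c * d) T i) ->
  forall x, g (h x) = k x.
Proof.
move=> gE hE kE; apply: (@hecke_hom_ext _ (g \o h)) => i /=.
have gT : g \o T = twist c T by apply/funext => j; apply: gE.
by rewrite hE kE twist_morph gT twistM mulrC.
Qed.

Lemma hecke_twist_id (g : {lrmorphism H -> H}) :
  (forall i, g (T i) = twist 1 T i) -> g =1 id.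
Proof. by move=> gE; apply: (@hecke_hom_ext _ g idfun) => i; rewrite gE twist1. Qed.

Lemma iter_hecke_twist c k (g h : {lrmorphism H -> H}) : c ^+ p = 1 ->
    (forall i, g (T i) = twist c T i) ->
    (forall i, h (T i) = twist (c ^+ k) T i) ->
  iter k g =1 h.
Proof.
move=> cp gE; elim: k h => [|k IH] h hE x; first by rewrite hecke_twist_id.
(* The induction hypothesis needs a morphism with factor c^k; the presentation supplies one. *)
have [|h' h'E] := @hecke_twist (c ^+ k); first by rewrite exprAC cp expr1n.
by rewrite iterS (IH h') //; apply: hecke_twist_comp gE h'E _ _ => i; rewrite hE exprS.
Qed.

Hypothesis f0 : f.[0] != 0.

(** T_1^p is a root of [f] and f(0) is nonzero, so T_1^p is a unit, hence so is T_1. *)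
Lemma hecke_T0_unit (i : 'I_n) : i = 0%N :> nat -> T i \is a GRing.unit.
Proof.
move=> i0; rewrite -(unitrX_pos _ p_gt0).
have [|-> //] := poly_inv (horner_hecke_T i0) f0 (G := S).
by apply: sub_gen_smallest; apply: hecke_t0.
Qed.

(** T_1^-p is not among the generators of B but is a polynomial in T_1^p. It is the image of X^-p
    under phi. *)
Lemma hecke_sub_T0V (i : 'I_n) : i = 0%N :> nat -> B (T i ^- p).
Proof.
move=> i0; have [|_ //] := poly_inv (horner_hecke_T i0) f0 (G := S).
by apply: sub_gen_smallest; apply: hecke_t0.
Qed.

Hypothesis q0 : q != 0.

(** The quadratic relation is a polynomial in T_i with constant term -q. *)
Lemma hecke_T_unit (i : 'I_n) : (0 < i)%N -> T i \is a GRing.unit /\ B (T i)^-1.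
Proof.
move=> i0; apply: (@poly_inv _ _ _ _ (('X - 1%:P) * ('X + q%:P))).
- rewrite rmorphM rmorphB rmorphD /= horner_algX !horner_algC scale1r.
  by apply/hecke_relP/cyclotomic_braid/braid_quad.
- by rewrite !hornerE mulN1r oppr_eq0.
- by apply: sub_gen_smallest; apply: hecke_ti.
Qed.

(** On generators, conjugation by T_1 fixes t_0, sends t_1 to T_2 and T_2 to T_2^-1 t_1 T_2, and
    fixes the remaining T_j, which commute with T_1. *)
Lemma hecke_sub_conj (i : 'I_n) x : i = 0%N :> nat -> B x -> B (T i * x * (T i)^-1).
Proof.
move=> i0; have ui := hecke_T0_unit i0.
have Bt := @sub_gen_smallest _ _ S.
have cB := gen_subalg_closed S; have /subalg_setP[_ _ BM] := cB.
apply: (smallest_sub (conj_subalg ui cB)) => {x} _ [j j0|j k j0 k1|j j0] /=.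
- have -> : j = i by apply: val_inj; rewrite /= j0.
  by rewrite -exprS exprSr mulrK //; apply: Bt; apply: hecke_t0.
- have -> : j = i by apply: val_inj; rewrite /= j0.
  by rewrite !mulrA mulrV // mul1r mulrK //; apply: Bt; apply: hecke_ti; rewrite k1.
have [j1|j1] := eqVneq (j : nat) 1%N.
  have [uj BjV] := hecke_T_unit j0.
  rewrite (braid4_conj uj ui); last first.
    by apply/hecke_relP/cyclotomic_braid; exact: (@braid4 _ _ _ _ T i j).
  apply: (BM); last by apply: Bt; apply: hecke_ti.
  by apply: BM => //; apply: Bt; apply: hecke_t1.
have -> : T i * T j = T j * T i.
  apply/hecke_relP/cyclotomic_braid/braid_far.
  by rewrite i0; case: (nat_of_ord j) j0 j1 => [|[|]].
by rewrite mulrK //; apply: Bt; apply: hecke_ti.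
Qed.

(** T_1^p acquires the factor c^p = 1, and in t_1 the factors c^-1 and c cancel. *)
Lemma hecke_sub_fixed (g : {lrmorphism H -> H}) c x : c ^+ p = 1 ->
    (forall i, g (T i) = twist c T i) -> B x -> g x = x.
Proof.
move=> cp gE.
apply: (smallest_sub (fixed_subalg g idfun)) => {x} _ [i i0|i j i0 j1|i i0] /=.
- by rewrite rmorphXn /= gE /twist i0 exprZn cp scale1r.
- have ui := hecke_T0_unit i0.
  have c0 : c != 0 by rewrite -unitfE -(unitrX_pos _ p_gt0) cp unitr1.
  rewrite !rmorphM /= rmorphV //= !gE /twist i0 j1 /=.
  rewrite invrZ ?unitfE // -scalerAr -!scalerAl scalerA divff // scale1r //.
- by rewrite gE /twist eqn0Ngt i0.
Qed.

Lemma sum_twist_hecke_sub (xi : K) (g : nat -> {lrmorphism H -> H}) (i : 'I_n) x :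
    p.-primitive_root xi -> (forall a j, g a (T j) = twist (xi ^+ a) T j) ->
    i = 0%N :> nat -> B (\sum_(a < p) g a x).
Proof.
move=> xiP gE i0; have ui := hecke_T0_unit i0.
have Bt := @sub_gen_smallest _ _ S.
have /subalg_setP[B1 BD BM] := gen_subalg_closed S.
have gX a k : g a (T i ^+ k) = (xi ^+ k) ^+ a *: T i ^+ k.
  by rewrite rmorphXn /= gE /twist i0 exprZn exprAC.
(* Induct on x with all k at once: as T_1 is a tau-eigenvector, averaging commutes
   with conjugation by T_1, and T_1 x T_1^k = T_1 (x T_1^(k+1)) T_1^-1. *)
suffices /(_ 0%N) : forall k, B (\sum_(a < p) g a (x * T i ^+ k)) by rewrite mulr1.
elim/hecke_ind: x => [|c x y Bx By|j x Bx] k.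
(* For x = 1 the sum is T_1^k times a geometric sum of ratio xi^k. If p divides k, T_1^k is a power
   of t_0. *)
- under eq_bigr do rewrite mul1r gX.
  rewrite -scaler_suml; have [/dvdnP[m ->]|pNk] := boolP (p %| k)%N.
    apply: gen_subalgZ; rewrite mulnC exprM; apply: gen_subalgX.
    by apply: Bt; apply: hecke_t0.
  (* Otherwise xi^k differs from 1 while its p-th power is 1, so the geometric sum vanishes. *)
  have := subrX1 (xi ^+ k) p; rewrite exprAC (prim_expr_order xiP) expr1n subrr.
  move/esym/eqP; rewrite mulf_eq0 subr_eq0 -(prim_order_dvd xiP) (negPf pNk) /=.
  by move/eqP->; rewrite scale0r -(scale0r 1); apply: gen_subalgZ.
- under eq_bigr do rewrite mulrDl -scalerAl linearP.
  by rewrite big_split /= -scaler_sumr; apply: BD; [apply: Bx|apply: By].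
have [j0|j0] := posnP j.
  have -> : j = i by apply: val_inj; rewrite /= j0.
  have -> : \sum_(a < p) g a (T i * x * T i ^+ k) =
      T i * (\sum_(a < p) g a (x * T i ^+ k.+1)) * (T i)^-1.
    rewrite mulr_sumr mulr_suml; apply: eq_bigr => a _.
    rewrite !rmorphM /= gE !gX /twist i0 /=.
    rewrite exprSr exprMn -!scalerAl -!scalerAr -!scalerAl scalerA.
    congr (_ *: _); first exact: mulrC.
    by rewrite exprSr !mulrA mulrK.
  exact: hecke_sub_conj.
(* Here T_j is fixed by every [g a] and lies in B, so it factors out of the sum. *)
under eq_bigr do rewrite -mulrA rmorphM /= gE /twist eqn0Ngt j0 /=.
rewrite -mulr_sumr; apply: BM; last exact: Bx.
by apply: Bt; apply: hecke_ti.
Qed.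

End Cyclotomic.

(** * The affine algebra and its quotient map *)

Section Affine.
Variables (K : fieldType) (n : nat) (q : K) (i0 : 'I_n).
Hypothesis i0E : i0 = 0%N :> nat.

Notation X := (affine_T q).

(** The generator X^-1 needs no separate check, since morphisms preserve inverses of units. *)
Lemma affine_hom_ext (A : unitAlgType K) (g h : {lrmorphism affine_hecke n q -> A}) :
  (forall i, g (X i) = h (X i)) -> g =1 h.
Proof.
move=> gh; have [uX XV] := affine_XinvE q i0E.
apply: affine_ind => [|a x y gx gy|[i|] x gx].
- by rewrite !rmorph1.
- by rewrite !linearP /= gx gy.
- by rewrite !rmorphM /= gh gx.
- by rewrite !rmorphM /= gx XV !rmorphV //= gh.
Qed.

(** Send X^-1 to c^-1 X^-1; with no order relation, any nonzero c is allowed. *)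
Lemma affine_twist c : c != 0 ->
  exists g : {lrmorphism affine_hecke n q -> affine_hecke n q},
    forall i, g (X i) = twist c X i.
Proof.
move=> c0; have [uX XV] := affine_XinvE q i0E.
pose t o := if o is Some i then twist c X i else c^-1 *: affine_Xinv n q.
have [|g gE] := @affine_lift _ n q _ t; last by exists g => i; apply: (gE (Some i)).
have i0_uniq (i : 'I_n) : i = 0%N :> nat -> i = i0.
  by move=> iE; apply: val_inj; rewrite /= iE.
move=> _ _ [x y|i /i0_uniq->|i /i0_uniq->].
- by apply: braid_rel_twist => {}x {}y xy; apply/affine_relP/affine_braid.
- by rewrite /t /twist i0E /= -scalerAl -scalerAr scalerA mulVf // scale1r XV mulVr.
- by rewrite /t /twist i0E /= -scalerAl -scalerAr scalerA mulfV // scale1r XV mulrV.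
Qed.

Lemma affine_twistK c (g h : {lrmorphism affine_hecke n q -> affine_hecke n q}) :
    c != 0 -> (forall i, g (X i) = twist c X i) ->
    (forall i, h (X i) = twist c^-1 X i) ->
  cancel g h.
Proof.
move=> c0 gE hE; apply: (@affine_hom_ext _ (h \o g) idfun) => i /=.
have hX : h \o X = twist c^-1 X by apply/funext => j; apply: hE.
by rewrite gE twist_morph hX twistM mulfV // twist1.
Qed.

(** Invertibility of T_1 provides the image of X^-1. *)
Lemma affine_quotient r (hr : (0 < r)%N) (u : 'I_r -> K) :
    hecke_T hr u q i0 \is a GRing.unit ->
  exists phi : {lrmorphism affine_hecke n q -> hecke n hr u q},
    forall i, phi (X i) = hecke_T hr u q i.
Proof.
move=> uT.
pose t o := if o is Some i then hecke_T hr u q i else (hecke_T hr u q i0)^-1.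
have [|g gE] := @affine_lift _ n q _ t; last by exists g => i; apply: (gE (Some i)).
have i0_uniq (i : 'I_n) : i = 0%N :> nat -> i = i0.
  by move=> iE; apply: val_inj; rewrite /= iE.
move=> _ _ [x y xy|i /i0_uniq->|i /i0_uniq->].
- exact/hecke_relP/cyclotomic_braid.
- exact: mulVr.
- exact: mulrV.
Qed.

Lemma affine_quotient_sub r (hr : (0 < r)%N) (u : 'I_r -> K) p
    (phi : {lrmorphism affine_hecke n q -> hecke n hr u q}) :
    (forall i, phi (X i) = hecke_T hr u q i) ->
    hecke_sub n hr u q p (hecke_T hr u q i0 ^- p) ->
  forall x, affine_sub n q p x -> hecke_sub n hr u q p (phi x).
Proof.
move=> phiE BV x.
have Bt := @sub_gen_smallest _ _ (@hecke_sub_gen K n r hr u q p).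
have cB := gen_subalg_closed (@hecke_sub_gen K n r hr u q p).
have i0_uniq (i : 'I_n) : i = 0%N :> nat -> i = i0.
  by move=> iE; apply: val_inj; rewrite /= iE.
have [uX _] := affine_XinvE q i0E.
apply: (smallest_sub (preimage_subalg phi cB))
    => {x} _ [i iE|i /i0_uniq->|i j iE jE|i iE]; rewrite /preimage /=.
- by rewrite rmorphXn /= phiE; apply: Bt; apply: hecke_t0.
- by rewrite rmorphV ?unitrX // rmorphXn /= phiE.
- rewrite !rmorphM /= rmorphV; last by rewrite (i0_uniq i iE).
  by rewrite /= !phiE; apply: Bt; apply: hecke_t1.
- by rewrite phiE; apply: Bt; apply: hecke_ti.
Qed.

Lemma affine_quotient_surj r (hr : (0 < r)%N) (u : 'I_r -> K)
    (phi : {lrmorphism affine_hecke n q -> hecke n hr u q}) :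
    (forall i, phi (X i) = hecke_T hr u q i) ->
  forall y, exists x, phi x = y.
Proof.
move=> phiE; apply: hecke_ind => [|a _ _ [x <-] [y <-]|i _ [x <-]].
- by exists 1; rewrite rmorph1.
- by exists (a *: x + y); rewrite linearP.
- by exists (X i * x); rewrite rmorphM /= phiE.
Qed.
End Affine.

(** * Automorphisms, group action, invariants and the diagram *)

Theorem theorem3p2 (R : realType) (n r p : nat)
    (hn : (2 <= n)%N) (hr : (0 < r)%N) (hp : (p %| r)%N)
    (xi q : R[i]) (hxi : p.-primitive_root xi) (hq : q != 0)
    (v : 'I_(r %/ p) -> R[i]) (hv : forall l, v l != 0)
    (u : 'I_r -> R[i])
    (hu : forall (j : 'I_r) (l : 'I_(r %/ p)) (k : 'I_p),
       j = (l * p + k)%N :> nat -> u j = xi ^+ k * v l) :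
  exists (tau : {lrmorphism hecke n hr u q -> hecke n hr u q})
         (tau_aff : {lrmorphism affine_hecke n q -> affine_hecke n q})
         (phi : {lrmorphism affine_hecke n q -> hecke n hr u q}),
  [/\ [/\ bijective tau,
          forall i, tau (hecke_T hr u q i) = twist xi (hecke_T hr u q) i
        & forall f : {lrmorphism hecke n hr u q -> hecke n hr u q},
            (forall i, f (hecke_T hr u q i) = twist xi (hecke_T hr u q) i) ->
            f =1 tau],
      exists to : action (Zp p) (hecke n hr u q),
        [/\ forall a, a \in Zp p ->
              exists2 f : {lrmorphism hecke n hr u q -> hecke n hr u q},
                bijective f & to^~ a =1 f,
            forall a, a \in Zp p -> to^~ a =1 iter a tau,
            forall a b, a \in Zp p -> b \in Zp p -> to^~ a =1 to^~ b -> a = b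
          & hecke_sub n hr u q p
            = [set x | forall a, a \in Zp p -> to x a = x]%classic],
      [/\ bijective tau_aff,
          forall i, tau_aff (affine_T q i) = twist xi (affine_T q) i
        & forall f : {lrmorphism affine_hecke n q -> affine_hecke n q},
            (forall i, f (affine_T q i) = twist xi (affine_T q) i) ->
            f =1 tau_aff],
      [/\ forall y : hecke n hr u q, exists x : affine_hecke n q, phi x = y,
          forall i, phi (affine_T q i) = hecke_T hr u q i
        & forall f : {lrmorphism affine_hecke n q -> hecke n hr u q},
            (forall i, f (affine_T q i) = hecke_T hr u q i) -> f =1 phi]
    & (forall x, affine_sub n q p x -> hecke_sub n hr u q p (phi x))
      /\ (forall x : affine_hecke n q, phi (tau_aff x) = tau (phi x))].
Proof.
have p0 : (0 < p)%N := prim_order_gt0 hxi.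
pose f := \prod_l ('X - (v l ^+ p)%:P).
have uE : \prod_(j < r) ('X - (u j)%:P) = f \Po 'X^p.
  (* The p roots xi^k v_l of block l contribute X^p - v_l^p. *)
  rewrite (prod_block (g := fun l k => 'X - (xi ^+ k * v l)%:P) hp) => [|j l k /hu-> //].
  rewrite rmorph_prod; apply: eq_bigr => l _.
  by rewrite prod_sub_prim_root // rmorphB /= comp_polyX comp_polyC.
have f0 : f.[0] != 0.
  rewrite horner_prod; apply/prodf_neq0 => l _.
  by rewrite !hornerE oppr_eq0 expf_neq0.
have n0 : (0 < n)%N by apply: leq_trans hn.
pose i0 := Ordinal n0; have i0E : i0 = 0%N :> nat by [].
have uT := hecke_T0_unit hr q p0 uE f0 i0E.
have xip m : (xi ^+ m) ^+ p = 1 by rewrite exprAC (prim_expr_order hxi) expr1n.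
(* All powers of tau are chosen at once as algebra morphisms: [g m] has factor xi^m, and tau is
   [g 1]. *)
have /choice[g gE] : forall m, exists g : {lrmorphism hecke n hr u q -> hecke n hr u q},
    forall i, g (hecke_T hr u q i) = twist (xi ^+ m) (hecke_T hr u q) i.
  by move=> m; apply: hecke_twist uE _ _.
have gD a b x : g a (g b x) = g (a + b)%N x.
  by apply: (hecke_twist_comp (gE a) (gE b)) => i; rewrite gE exprD.
have gmod a b : a = b %[mod p] -> g a =1 g b.
  move=> /eqP; rewrite -(eq_prim_root_expr hxi) => /eqP ab.
  by apply: hecke_hom_ext => i; rewrite !gE ab.
have g0 : g 0%N =1 id by apply: hecke_twist_id => i; rewrite gE.
(* The exponents add up to a p, which is 0 modulo p. *)
have gK a : cancel (g a) (g (a * p.-1)%N).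
  by move=> x; rewrite gD addnC -mulnS prednK // (gmod _ 0%N) ?modnMl ?mod0n // g0.
have gK' a : cancel (g (a * p.-1)%N) (g a).
  by move=> x; rewrite gD -mulnS prednK // (gmod _ 0%N) ?modnMl ?mod0n // g0.
have g_bij a : bijective (g a) by exists (g (a * p.-1)%N).
have xi0 : xi != 0 by rewrite -unitfE -(unitrX_pos _ p0) (prim_expr_order hxi) unitr1.
(* From here [tau] is the automorphism of the affine algebra, with inverse [tau']. *)
have [tau tauE] := affine_twist q i0E xi0.
have xiV0 : xi^-1 != 0 by rewrite invr_eq0.
have [tau' tau'E] := affine_twist q i0E xiV0.
have [phi phiE] := affine_quotient i0E uT.
exists (g 1%N), tau, phi; split.
- split=> [//|i|h hE]; first by rewrite gE.
  by apply: hecke_hom_ext => i; rewrite hE gE.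
- have p1E : (p <= 1)%N -> p = 1%N by move=> p1; apply/eqP; rewrite eqn_leq p1.
  (* For p = 1 the type ['Z_p] has two elements and [Zp p] is its trivial subgroup. In every case p
     divides the modulus used for addition in ['Z_p]. *)
  have dvd_p : (p %| (Zp_trunc p).+2)%N.
    by have [p1|/p1E->] := ltnP 1 p; [rewrite Zp_cast|apply: dvd1n].
  pose to x (a : 'Z_p) := g a x.
  have toA : is_action (Zp p) to.
    split=> [a|x a b _ _]; first exact: can_inj (gK a).
    by rewrite /to gD; apply: gmod; rewrite /= addnC modn_dvdm.
  exists (Action toA); split=> [a _|a _ x|a b aZ bZ ab|] /=.
  + by exists (g a).
  + by rewrite (iter_hecke_twist uE _ (gE 1%N) (h := g a)) // => i; rewrite gE expr1.
  (* Faithfulness is read off at T_1: it is a unit, hence nonzero, so xi^a = xi^b. *)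
  + have /eqP := ab (hecke_T hr u q i0); rewrite /= /to !gE /twist /=.
    rewrite -subr_eq0 -scalerBl scaler_eq0 subr_eq0 (eq_prim_root_expr hxi).
    rewrite orbC; case: eqP uT => [->|_ _ /=]; first by rewrite unitr0.
    have [p1|p1] := boolP (1 < p)%N; last first.
      by move: aZ bZ; rewrite /Zp (negPf p1) !inE => /eqP-> /eqP->.
    have lt_p (x : 'Z_p) : (x < p)%N by rewrite -[X in (_ < X)%N](Zp_cast p1).
    by rewrite !modn_small // => /eqP ab'; apply: val_inj.
  apply/seteqP; split=> [x Bx a _|x xfix] /=.
    exact: (hecke_sub_fixed p0 uE f0 (xip a) (gE a)).
  (* For p > 1 the element 1 lies in [Zp p]; for p = 1 the map [g 1] is the identity. *)
  have x1 : g 1%N x = x.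
    have [p1|p1] := ltnP 1 p.
      by have := xfix 1%R; rewrite /Zp p1 inE; apply.
    by rewrite (gmod _ 0%N) ?g0 // (p1E p1) !modn1.
  have xa a : g a x = x by elim: a => [|a IH]; rewrite ?g0 // -addn1 -gD x1.
  have := sum_twist_hecke_sub p0 uE f0 hq x hxi gE i0E.
  under eq_bigr do rewrite xa.
  (* The sum is p x, and p is invertible in characteristic zero. *)
  rewrite sumr_const card_ord -scaler_nat => /(gen_subalgZ (p%:R^-1)).
  by rewrite scalerA mulVf ?scale1r // Num.Theory.pnatr_eq0 -lt0n.
- split=> [|//|h hE]; last by apply: (affine_hom_ext i0E) => i; rewrite hE tauE.
  exists tau'; first exact: (affine_twistK i0E xi0 tauE tau'E).
  by apply: (affine_twistK i0E xiV0 tau'E) => i; rewrite invrK.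
- split=> [|//|h hE]; first exact: affine_quotient_surj.
  by apply: (affine_hom_ext i0E) => i; rewrite hE phiE.
split.
  by apply: (affine_quotient_sub i0E phiE); apply: (hecke_sub_T0V uE f0).
apply: (affine_hom_ext i0E (g := phi \o tau) (h := g 1%N \o phi)) => i /=.
have phiT : phi \o affine_T q = hecke_T hr u q by apply/funext => j; apply: phiE.
by rewrite phiE tauE gE expr1 twist_morph phiT.
Qed.
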